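(* Let $M,N\geq 0$ be integers and let $k$ be a positive integer. Then: (i) if $|M-N|\leq k$, the trigonometric polynomial $$\sum_{l\in\mathbb{Z}}\binom{M+N}{M-kl}^2 \cos(lx)$$ is a polynomial in $1+\cos(x)$ with nonnegative integer coefficients; (ii) the trigonometric polynomial $$\sum_{l\in\mathbb{Z}}\binom{M+N}{M-kl}\binom{M+N}{N-kl} \cos(lx)$$ is a polynomial in $1+\cos(x)$ with nonnegative integer coefficients.
   Context: Binomial coefficients $\binom{n}{j}$ are taken to be $0$ when $j<0$ or $j>n$, so all sums over $l\in\mathbb{Z}$ are finite. *)

(* Defs.v *)
From HB Require Import structures.
From mathcomp Require Import all_boot all_order all_algebra.
From mathcomp Require Import all_classical all_reals all_analysis.

Set Implicit Arguments.
Unset Strict Implicit.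
Unset Printing Implicit Defensive.

Import Order.TTheory GRing.Theory Num.Theory.
Local Open Scope ring_scope.

(* Binomial coefficient with an integer lower index: it vanishes for j < 0
   by the second branch and for j > n by ssrnat's convention on 'C(n, m). *)
Definition binz (n : nat) (j : int) : nat :=
  match j with
  | Posz m => 'C(n, m)
  | Negz _ => 0%N
  end.

(* Both sides are compared as functions on the real line. *)
Definition nneg_int_poly_in_1Dcos (R : realType) (f : R -> R) : Prop :=
  exists p : {poly int},
    (forall i : nat, 0 <= p`_i) /\
    (forall x : R, f x = (map_poly (intr : int -> R) p).[1 + cos x]).

(* Main.v *)
(* Put n = M + N, c = v + 1/v and z = v^2. The coefficient of u^s in
   (1 + u v)^n (1 + u / v)^n = (1 + c u + u^2)^n is on the one hand a sum of
   products of two binomials, on the other hand a polynomial in c with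
   nonnegative coefficients; s = n and s = 2 M give the two sums of the theorem,
   once only the exponents of v in the right class modulo 2 k are kept.
   Multiplication by c turns this extraction into a nearest-neighbour walk on
   the integers, quasi-periodic with period 2 k. Taking real parts folds the
   walk onto the segment [0, k], together with a companion walk carrying an
   extra half-angle, and crossing from one to the other at the ends of the
   segment costs cos (x / 2), so that the weight 2 cos (x / 2) ^ 2 = 1 + cos x
   is the only one to appear. The hypothesis |M - N| <= k says that the walk
   starts on this segment. *)
Require Import Defs.
From HB Require Import structures.
From mathcomp Require Import all_boot all_order all_algebra.
From mathcomp Require Import all_classical all_reals all_analysis.
From mathcomp Require Import zify ring lra.

Set Implicit Arguments.
Unset Strict Implicit.
Unset Printing Implicit Defensive.

Import Order.TTheory GRing.Theory Num.Theory.
Local Open Scope classical_set_scope.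
Local Open Scope ring_scope.

(** * Closure properties of nonnegative integer polynomials in [1 + cos x] *)

Section NonnegativePolynomials.
Variable R : realType.
Implicit Types f g : R -> R.

Lemma nneg_int_poly_ext f g :
  f =1 g -> nneg_int_poly_in_1Dcos f -> nneg_int_poly_in_1Dcos g.
Proof. by move=> fg [p [p_ge0 fE]]; exists p; split=> // x; rewrite -fg. Qed.

Lemma nneg_int_poly0 : nneg_int_poly_in_1Dcos (fun=> 0 : R).
Proof.
by exists 0; split=> [i|x]; rewrite ?coef0// rmorph0 horner0.
Qed.

Lemma nneg_int_poly1 : nneg_int_poly_in_1Dcos (fun=> 1 : R).
Proof.
exists 1; split=> [i|x]; last by rewrite rmorph1 hornerC.
by rewrite coef1; case: eqP.
Qed.

Lemma nneg_int_polyD f g :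
  nneg_int_poly_in_1Dcos f -> nneg_int_poly_in_1Dcos g ->
  nneg_int_poly_in_1Dcos (f \+ g).
Proof.
move=> [p [p_ge0 fE]] [q [q_ge0 gE]]; exists (p + q); split=> [i|x].
  by rewrite coefD addr_ge0.
by rewrite /= fE gE rmorphD hornerD.
Qed.

Lemma nneg_int_poly_1DcosM f :
  nneg_int_poly_in_1Dcos f ->
  nneg_int_poly_in_1Dcos (fun x => (1 + cos x) * f x).
Proof.
move=> [p [p_ge0 fE]]; exists ('X * p); split=> [i|x].
  by rewrite coefXM; case: eqP.
by rewrite fE rmorphM /= map_polyX hornerM hornerX.
Qed.

End NonnegativePolynomials.

Lemma cos_half (R : realType) (x : R) : 2 * cos (x / 2) ^+ 2 = 1 + cos x.
Proof.
have -> : cos x = cos ((x / 2) *+ 2) by congr cos; rewrite mulr2n -splitr.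
by rewrite cos_mulr2n mulr2n; ring.
Qed.

(** * Walks folded onto a segment *)

Section FoldedWalks.
Variables (R : realType) (k : nat).
Hypothesis k_gt0 : (0 < k)%N.
Implicit Types F G : R -> int -> R.

Definition nbr_sum F : R -> int -> R := fun x d => F x (d - 1) + F x (d + 1).

(* Invariant of the pair [wave k 0], [wave k 2^-1] below under [nbr_sum]. [F] is
   reflected at [0] and [G] at [k]; the two relations with [2 cos (x / 2)]
   close the recurrence on the segment [0, k], since [F x k] and [G x 0] are
   recovered as [cos (x / 2) * G x k] and [cos (x / 2) * F x 0]. *)
Record walk_pair F G : Prop := WalkPair {
  walkFN : forall x d, F x (- d) = F x d ;
  walkGB : forall x d, G x (k%:Z *+ 2 - d) = G x d ;
  walkFF : forall x d,
    F x d + F x (d + k%:Z *+ 2) = 2 * cos (x / 2) * G x (d + k%:Z *+ 2) ;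
  walkGG : forall x d, G x d + G x (d + k%:Z *+ 2) = 2 * cos (x / 2) * F x d ;
  walkF_nneg : forall d : int, 0 <= d < k%:Z ->
    nneg_int_poly_in_1Dcos (F^~ d) ;
  walkG_nneg : forall d : int, 0 < d < k%:Z ->
    exists2 f, nneg_int_poly_in_1Dcos f & forall x, G x d = cos (x / 2) * f x ;
  walkGk_nneg : exists2 f, nneg_int_poly_in_1Dcos f &
    forall x, G x k%:Z = 2 * cos (x / 2) * f x }.

(** At [d = - k] the two terms on the left of [walkFF] coincide by evenness. *)
Lemma walkFk F G x : walk_pair F G -> F x k%:Z = cos (x / 2) * G x k%:Z.
Proof.
move=> FG; have := walkFF FG x (- k%:Z); rewrite (walkFN FG).
have -> : - k%:Z + k%:Z *+ 2 = k%:Z by lia.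
by lra.
Qed.

Lemma walkG0 F G x : walk_pair F G -> G x 0 = cos (x / 2) * F x 0.
Proof.
move=> FG; have := walkGG FG x 0; have := walkGB FG x 0.
by rewrite subr0 add0r; lra.
Qed.

(** At the end [k] the factor [2 * cos (x / 2)] of [G x k] meets the [cos (x / 2)] of [walkFk]: this
    is where the weight [1 + cos x] is produced. *)
Lemma walkF_nneg_le F G (d : int) : walk_pair F G -> 0 <= d <= k%:Z ->
  nneg_int_poly_in_1Dcos (F^~ d).
Proof.
move=> FG /andP[d_ge0]; rewrite le_eqVlt => /predU1P[->|d_ltk]; last first.
  by apply: (walkF_nneg FG); rewrite d_ge0.
have [f f_nneg GE] := walkGk_nneg FG.
apply: nneg_int_poly_ext (nneg_int_poly_1DcosM f_nneg) => x.
by rewrite (walkFk x FG) GE -cos_half; ring.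
Qed.

Lemma walkG_nneg_lt F G (d : int) : walk_pair F G -> 0 <= d < k%:Z ->
  exists2 f, nneg_int_poly_in_1Dcos f & forall x, G x d = cos (x / 2) * f x.
Proof.
move=> FG /andP[]; rewrite le_eqVlt => /predU1P[<- _|d_gt0 d_ltk].
  exists (F^~ 0) => [|x]; last exact: walkG0.
  by apply: (walkF_nneg_le FG); lia.
by apply: (walkG_nneg FG); rewrite d_gt0.
Qed.

Lemma walkG_nneg_le F G (d : int) : walk_pair F G -> 0 <= d <= k%:Z ->
  exists2 f, nneg_int_poly_in_1Dcos f & forall x, G x d = cos (x / 2) * f x.
Proof.
move=> FG /andP[d_ge0]; rewrite le_eqVlt => /predU1P[->|d_ltk]; last first.
  by apply: (walkG_nneg_lt FG); rewrite d_ge0.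
have [f f_nneg GE] := walkGk_nneg FG; exists (f \+ f) => [|x].
  exact: nneg_int_polyD.
by rewrite GE /=; ring.
Qed.

Lemma walk_pair0 : walk_pair (fun _ _ => 0) (fun _ _ => 0).
Proof.
have n0 := nneg_int_poly0 R.
by split=> *; rewrite ?mulr0 ?addr0//; exists (fun=> 0) => // x; rewrite mulr0.
Qed.

Lemma walk_pairD F1 G1 F2 G2 : walk_pair F1 G1 -> walk_pair F2 G2 ->
  walk_pair (fun x d => F1 x d + F2 x d) (fun x d => G1 x d + G2 x d).
Proof.
move=> FG1 FG2; split.
- by move=> x d; rewrite !(walkFN FG1, walkFN FG2).
- by move=> x d; rewrite !(walkGB FG1, walkGB FG2).
- by move=> x d; have := walkFF FG1 x d; have := walkFF FG2 x d; lra.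
- by move=> x d; have := walkGG FG1 x d; have := walkGG FG2 x d; lra.
- move=> d dk; apply: nneg_int_polyD; first exact: walkF_nneg FG1 _ _.
  exact: walkF_nneg FG2 _ _.
- move=> d dk; have [f1 f1_nneg GE1] := walkG_nneg FG1 dk.
  have [f2 f2_nneg GE2] := walkG_nneg FG2 dk.
  exists (f1 \+ f2) => [|x]; first exact: nneg_int_polyD.
  by rewrite GE1 GE2 /=; ring.
- have [f1 f1_nneg GE1] := walkGk_nneg FG1.
  have [f2 f2_nneg GE2] := walkGk_nneg FG2.
  exists (f1 \+ f2) => [|x]; first exact: nneg_int_polyD.
  by rewrite GE1 GE2 /=; ring.
Qed.

(** Neighbours of interior sites stay in the segment. At [0] the reflection of [F] doubles [F x 1];
    at [k] that of [G] doubles [G x (k - 1)], which supplies the factor 2 of [walkGk_nneg]. *)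
Lemma walk_pair_nbr_sum F G :
  walk_pair F G -> walk_pair (nbr_sum F) (nbr_sum G).
Proof.
move=> FG; rewrite /nbr_sum; split.
- move=> x d; rewrite -(walkFN FG) -[X in _ + X](walkFN FG) addrC.
  by congr (F x _ + F x _); lia.
- move=> x d; rewrite -(walkGB FG) -[X in _ + X](walkGB FG) addrC.
  by congr (G x _ + G x _); lia.
- move=> x d; rewrite !(addrAC d (k%:Z *+ 2)) mulrDr -!(walkFF FG); ring.
- move=> x d; rewrite !(addrAC d (k%:Z *+ 2)) mulrDr -!(walkGG FG); ring.
- move=> d /andP[]; rewrite le_eqVlt => /predU1P[<- _|d_gt0 d_ltk].
    apply: (@nneg_int_poly_ext _ (F^~ 1 \+ F^~ 1)) => [x /=|].
      by rewrite sub0r add0r (walkFN FG).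
    by apply: nneg_int_polyD; apply: (walkF_nneg_le FG); lia.
  by apply: nneg_int_polyD; apply: (walkF_nneg_le FG); lia.
- move=> d dk.
  have [|f f_nneg fE] := @walkG_nneg_le F G (d - 1) FG; first lia.
  have [|g g_nneg gE] := @walkG_nneg_le F G (d + 1) FG; first lia.
  exists (f \+ g) => [|x]; first exact: nneg_int_polyD.
  by rewrite fE gE /=; ring.
- have [|f f_nneg fE] := @walkG_nneg_lt F G (k%:Z - 1) FG; first lia.
  exists f => // x; rewrite -[X in _ + X](walkGB FG) -mulrA -fE.
  have -> : k%:Z *+ 2 - (k%:Z + 1) = k%:Z - 1 by lia.
  by ring.
Qed.

(** Real part of the extraction: [v ^ d] survives only for [d = 2 k l], with frequency [l]; taking
    [t] to be one half gives the companion walk. *)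
Definition wave (t : R) : R -> int -> R := fun x d =>
  if (k%:Z *+ 2 %| d)%Z then cos (((d %/ (k%:Z *+ 2))%Z%:~R - t) * x) else 0.

Lemma waveM t x (l : int) : wave t x (l * (k%:Z *+ 2)) = cos ((l%:~R - t) * x).
Proof. by rewrite /wave dvdz_mull// mulzK//; lia. Qed.

Lemma wave_ndvd t x d : ~~ (k%:Z *+ 2 %| d)%Z -> wave t x d = 0.
Proof. by rewrite /wave => /negPf ->. Qed.

Lemma walk_pair_wave : walk_pair (wave 0) (wave 2^-1).
Proof.
have wave_small t x d : 0 < d < k%:Z *+ 2 -> wave t x d = 0.
  have k2_gt0 : 0 < k%:Z *+ 2 by lia.
  move=> dk; apply: wave_ndvd; apply/negP => /dvdzP[q dE]; move: dk.
  by rewrite dE pmulr_lgt0// gtr_pMl//; lia.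
have dvdDk d : (k%:Z *+ 2 %| d + k%:Z *+ 2)%Z = (k%:Z *+ 2 %| d)%Z.
  by rewrite rpredDr ?dvdzz.
have addk2 (q : int) : q * (k%:Z *+ 2) + k%:Z *+ 2 = (q + 1) * (k%:Z *+ 2).
  by rewrite mulrDl mul1r.
have n1 := nneg_int_poly1 R; have n0 := nneg_int_poly0 R.
(* Consecutive frequencies combine into their midpoint, which exchanges [t = 0] and [t = 2^-1]. *)
have cosDB (x a : R) :
    cos (a + x / 2) + cos (a - x / 2) = 2 * cos (x / 2) * cos a.
  by rewrite cosD cosB; ring.
split.
- move=> x d; have [/dvdzP[q ->]|dN] := boolP (k%:Z *+ 2 %| d)%Z.
    by rewrite -mulNr !waveM -[RHS]cosN; congr cos; rewrite rmorphN /=; ring.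
  by rewrite !wave_ndvd// rpredN.
- move=> x d; have [/dvdzP[q ->]|dN] := boolP (k%:Z *+ 2 %| d)%Z.
    rewrite -[X in X - _]mul1r -mulrBl !waveM -[RHS]cosN; congr cos.
    by rewrite rmorphB /=; field.
  by rewrite !wave_ndvd// addrC dvdDk rpredN.
- move=> x d; have [/dvdzP[q ->]|dN] := boolP (k%:Z *+ 2 %| d)%Z.
    rewrite addk2 !waveM -cosDB addrC rmorphD /=.
    by congr (cos _ + cos _); field.
  by rewrite !wave_ndvd ?dvdDk// mulr0 addr0.
- move=> x d; have [/dvdzP[q ->]|dN] := boolP (k%:Z *+ 2 %| d)%Z.
    rewrite addk2 !waveM -cosDB addrC rmorphD /=.
    by congr (cos _ + cos _); field.
  by rewrite !wave_ndvd ?dvdDk// mulr0 addr0.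
- move=> d /andP[]; rewrite le_eqVlt => /predU1P[<- _|d_gt0 d_ltk].
    apply: nneg_int_poly_ext n1 => x.
    by have := waveM 0 x 0; rewrite mul0r => ->; rewrite subrr mul0r cos0.
  by apply: nneg_int_poly_ext n0 => x; rewrite wave_small//; lia.
- by move=> d dk; exists (fun=> 0) => // x; rewrite wave_small ?mulr0//; lia.
- by exists (fun=> 0) => // x; rewrite wave_small ?mulr0//; lia.
Qed.

(* Coefficient of [u ^+ s] in [(1 + u / v) ^+ n * (1 + u * v) ^+ m], each power
   [v ^ e] being replaced by [F x (e + d)]. *)
Definition bin_conv (n m s : nat) F : R -> int -> R := fun x d =>
  \sum_(a < s.+1) 'C(n, a)%:R * 'C(m, s - a)%:R * F x (s%:Z - a%:Z *+ 2 + d).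

Lemma bin_conv0 n m F x d : bin_conv n m 0 F x d = F x d.
Proof. by rewrite /bin_conv big_ord1 /= !bin0 !mul1r mul0rn subr0 add0r. Qed.

Lemma bin_convS0 s F x d : bin_conv 0 0 s.+1 F x d = 0.
Proof.
rewrite /bin_conv big1// => -[[|a] a_lts] _ /=; last by rewrite bin0n !mul0r.
by rewrite subn0 (bin0n s.+1) mulr0 mul0r.
Qed.

(** Pascal's rule, that is, one more factor [1 + u / v]. *)
Lemma bin_convSl n m s F x d :
  bin_conv n.+1 m s.+1 F x d =
    bin_conv n m s.+1 F x d + bin_conv n m s F x (d - 1).
Proof.
rewrite /bin_conv big_ord_recl [in RHS]big_ord_recl /= !bin0 -[RHS]addrA.
congr (_ + _); rewrite -big_split /=; apply: eq_bigr => a _.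
rewrite /bump /= add1n subSS binS natrD !mulrDl; congr (_ + _).
by congr (_ * F x _); lia.
Qed.

Lemma bin_convSr n m s F x d :
  bin_conv n m.+1 s.+1 F x d =
    bin_conv n m s.+1 F x d + bin_conv n m s F x (d + 1).
Proof.
rewrite /bin_conv big_ord_recr [X in _ = X + _]big_ord_recr /= subnn.
rewrite !bin0 [RHS]addrAC; congr (_ + _); rewrite -big_split /=.
apply: eq_bigr => a _.
rewrite subSn -1?ltnS// binS natrD mulrDr mulrDl; congr (_ + _).
by congr (_ * F x _); lia.
Qed.

Lemma walk_pair_ext F G F' G' : (forall x d, F x d = F' x d) ->
  (forall x d, G x d = G' x d) -> walk_pair F G -> walk_pair F' G'.
Proof.
move=> FF' GG'; have <- : F = F' by apply/funext => x; apply/funext.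
by have <- : G = G' by apply/funext => x; apply/funext.
Qed.

(** Since [(1 + u / v) * (1 + u * v) = 1 + c * u + u ^ 2], raising [n] only takes sums and
    [nbr_sum]; the cases [s = 0] and [s = 1] lack the terms of negative degree. *)
Lemma walk_pair_bin_conv n s F G : walk_pair F G ->
  walk_pair (bin_conv n n s F) (bin_conv n n s G).
Proof.
move=> FG; elim: n s => [|n IHn] [|[|s]].
- by apply: walk_pair_ext FG => x d; rewrite bin_conv0.
- by apply: walk_pair_ext walk_pair0 => x d; rewrite bin_convS0.
- by apply: walk_pair_ext walk_pair0 => x d; rewrite bin_convS0.
- by apply: walk_pair_ext FG => x d; rewrite bin_conv0.
- apply: walk_pair_ext (walk_pairD (IHn 1%N) (walk_pair_nbr_sum FG)) => x d;
  by rewrite /nbr_sum bin_convSl bin_convSr !bin_conv0; ring.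
- apply: walk_pair_ext (walk_pairD (walk_pairD (IHn s.+2)
    (walk_pair_nbr_sum (IHn s.+1))) (IHn s)) => x d;
  by rewrite /nbr_sum bin_convSl !bin_convSr subrK; ring.
Qed.

Lemma bin_conv_wave_nneg n s (d : int) : `|d| <= k%:Z ->
  nneg_int_poly_in_1Dcos ((bin_conv n n s (wave 0))^~ d).
Proof.
move=> dk; have FG := walk_pair_bin_conv n s walk_pair_wave.
have [d_ge0|d_lt0] := lerP 0 d; first by apply: (walkF_nneg_le FG); lia.
apply: (@nneg_int_poly_ext _ ((bin_conv n n s (wave 0))^~ (- d))) => [x|].
  exact: (walkFN FG).
by apply: (walkF_nneg_le FG); lia.
Qed.

(** The exponent in [bin_conv] becomes [2 (M - a)], a multiple of [2 k] exactly when [a = M - k l]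
    for some [l]. *)
Lemma fsum_binz_cos n M s x :
  \sum_(l \in [set: int]) ((binz n (M%:Z - k%:Z * l))%:R
      * (binz n (s%:Z - (M%:Z - k%:Z * l)))%:R * cos (l%:~R * x))
  = bin_conv n n s (wave 0) x (M%:Z *+ 2 - s%:Z).
Proof.
pose P : set int := [set l | 0 <= M%:Z - k%:Z * l <= s%:Z].
pose Q : set nat := [set a : nat | (a < s.+1)%N /\ (k%:Z %| M%:Z - a%:Z)%Z].
(* On [P] the argument is nonnegative, so [absz] loses nothing. *)
pose h (l : int) : nat := absz (M%:Z - k%:Z * l)%R.
rewrite /bin_conv (fsbig_ord _ s.+1 (fun a : nat => 'C(n, a)%:R
  * 'C(n, s - a)%:R * wave 0 x (s%:Z - a%:Z *+ 2 + (M%:Z *+ 2 - s%:Z)))).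
rewrite -(@fsbig_widen _ _ _ _ P) //; last first.
  move=> l [_ /= /negP lP]; have [lt0|ge0] := ltP (M%:Z - k%:Z * l) 0.
    by case: (M%:Z - k%:Z * l) lt0 => //= a _; rewrite !mul0r.
  have : s%:Z - (M%:Z - k%:Z * l) < 0 by lia.
  by case: (s%:Z - (M%:Z - k%:Z * l)) => //= a _; rewrite mulr0 mul0r.
rewrite -(@fsbig_widen _ _ _ _ Q) //; first last.
- move=> a [/= a_lts aQ]; rewrite wave_ndvd ?mulr0//.
  apply/negP => /dvdzP[q qE]; apply: aQ; split=> //.
  by apply/dvdzP; exists q; lia.
- by move=> a [].
rewrite [RHS](@reindex_fsbig _ _ _ _ _ h P).
  apply: eq_fsbigr => l; rewrite inE /P /= => lP.
  have hE : M%:Z - k%:Z * l = (h l)%:Z by rewrite /h; lia.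
  rewrite hE; have -> : s%:Z - (h l)%:Z = (s - h l)%N%:Z by lia.
  have -> : s%:Z - (h l)%:Z *+ 2 + (M%:Z *+ 2 - s%:Z) = l * (k%:Z *+ 2).
    by rewrite -hE; ring.
  by rewrite waveM subr0.
split.
- move=> l; rewrite /P /Q /= => lP; split; first by rewrite /h; lia.
  by apply/dvdzP; exists l; rewrite /h; lia.
- move=> l l'; rewrite !inE /P /h /= => lP lP' hE.
  have : k%:Z * l = k%:Z * l' by lia.
  by apply: mulfI; lia.
- move=> a [/= a_lts /dvdzP[q qE]]; exists q; rewrite /P /h /=; lia.
Qed.

End FoldedWalks.

Lemma binz_sub n (j : int) : binz n (n%:Z - j) = binz n j.
Proof.
case: j => j; last first.
  have -> : n%:Z - Negz j = (n + j.+1)%N%:Z by lia.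
  by rewrite /= bin_small//; lia.
have [jn|nj] := leqP j n.
  have -> : n%:Z - j%:Z = (n - j)%N%:Z by lia.
  by rewrite /= bin_sub.
rewrite [RHS]/= bin_small//; have : n%:Z - j%:Z < 0 by lia.
by case: (n%:Z - j%:Z).
Qed.

Theorem theorem1p1 (R : realType) (M N k : nat) (hk : (0 < k)%N) :
  (`|M%:Z - N%:Z| <= k%:Z ->
     nneg_int_poly_in_1Dcos (fun x : R =>
       \sum_(l \in [set: int])
         ((binz (M + N) (M%:Z - k%:Z * l))%:R ^+ 2 * cos (l%:~R * x))))
  /\
  nneg_int_poly_in_1Dcos (fun x : R =>
    \sum_(l \in [set: int])
      ((binz (M + N) (M%:Z - k%:Z * l))%:R
       * (binz (M + N) (N%:Z - k%:Z * l))%:R * cos (l%:~R * x))).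
Proof.
split=> [MNk|].
  (* With [s = M + N] the walk starts at [M - N], and symmetry makes the two binomials equal. *)
  apply: nneg_int_poly_ext (bin_conv_wave_nneg R hk (M + N) (M + N) MNk) => x.
  have -> : M%:Z - N%:Z = M%:Z *+ 2 - (M + N)%N%:Z by lia.
  rewrite -(fsum_binz_cos hk); apply: eq_fsbigr => l _.
  by rewrite binz_sub expr2.
(* With [s = 2 M] the walk starts at [0]; symmetry turns the lower index [M + k l] into
   [N - k l]. *)
have d0 : `|M%:Z *+ 2 - (M.*2)%:Z| <= k%:Z by lia.
apply: nneg_int_poly_ext (bin_conv_wave_nneg R hk (M + N) (M.*2) d0) => x.
rewrite -(fsum_binz_cos hk); apply: eq_fsbigr => l _.
by rewrite -[in X in _ * X * _]binz_sub; congr (_ * (binz _ _)%:R * _); lia.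
Qed.
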